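(* Let $a\in\mathbb C$ and $b\in\mathbb C\setminus\mathbb Z_{\le0}$. For $x\ne y$, $$F_1(a;1,1;b;x,y)=\frac{x\,{}_2F_1(a,1;b;x)-y\,{}_2F_1(a,1;b;y)}{x-y},$$ i.e. $F_1(a;1,1;b;x,y)$ is the divided difference $[x,y]\big(z\,{}_2F_1(a,1;b;z)\big)$, and $$F_1(a;1,2;b;x,y)=\frac{1}{b(x-y)^2}\Big[b\,x^2\,{}_2F_1(a,1;b;x)+b\,y^2\,{}_2F_1(a,2;b;y)+x\Big(-a\,y^2\,{}_2F_1(a+1,2;b+1;y)-2b\,y\,{}_2F_1(a,1;b;y)\Big)\Big].$$
   Context: ${}_2F_1$ is the Gauss hypergeometric function and $F_1$ is Appell's first hypergeometric function, defined for $|x|,|y|<1$ by $$F_1(a;\beta,\beta';c;x,y)=\sum_{p,q\ge0}\frac{(a)_{p+q}(\beta)_p(\beta')_q}{p!\,q!\,(c)_{p+q}}x^py^q,$$ with $(q)_n=\Gamma(q+n)/\Gamma(q)$ the Pochhammer symbol; both are extended by analytic continuation to $x,y\in\mathbb C\setminus[1,\infty)$. The divided difference is $[x,y](T(z))=\frac{T(x)-T(y)}{x-y}$. *)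

(* Defs.v *)
From Stdlib Require Import Factorial Reals.
From Coquelicot Require Import Coquelicot.
Open Scope C_scope.

(* The quotient Gamma(q+n)/Gamma(q), with its poles cancelled: as a product
   q(q+1)...(q+n-1) it makes sense for every complex q. *)
Fixpoint pochhammer (q : C) (n : nat) : C :=
  match n with
  | O => 1
  | S m => pochhammer q m * (q + RtoC (INR m))
  end.

Definition Cfact (n : nat) : C := RtoC (INR (fact n)).

(* The parameter set C \ Z_{<= 0}. *)
Definition not_nonpos_int (b : C) : Prop :=
  forall n : nat, b <> RtoC (- INR n).

(* C \ [1, +oo). *)
Definition cut_plane (z : C) : Prop := ~ (Im z = 0%R /\ (1 <= Re z)%R).

(* Absolute convergence of the double series sum_{p,q >= 0} u p q, with sum l;
   the rectangular partial sums are indexed by pairs (P, Q). *)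
Definition is_series2 (u : nat -> nat -> C) (l : C) : Prop :=
  (exists M : R, forall P Q : nat,
      (sum_n (fun p => sum_n (fun q => Cmod (u p q)) Q) P <= M)%R) /\
  filterlim (fun PQ : nat * nat =>
               sum_n (fun p => sum_n (fun q => u p q) (snd PQ)) (fst PQ))
            (filter_prod eventually eventually) (locally l).

Definition analytic_on (D : C -> Prop) (f : C -> C) : Prop :=
  forall z0 : C, D z0 ->
  exists (c : nat -> C) (r : R), (0 < r)%R /\
    forall z : C, (Cmod (z - z0) < r)%R ->
      is_series (fun n => c n * (z - z0) ^ n) (f z).

(* Joint analyticity on D x D. *)
Definition analytic2_on (D : C -> Prop) (F : C -> C -> C) : Prop :=
  forall x0 y0 : C, D x0 -> D y0 ->
  exists (c : nat -> nat -> C) (r : R), (0 < r)%R /\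
    forall x y : C, (Cmod (x - x0) < r)%R -> (Cmod (y - y0) < r)%R ->
      is_series2 (fun p q => c p q * (x - x0) ^ p * (y - y0) ^ q) (F x y).

(* [f] is z |-> 2F1(a, b; c; z) continued analytically to [cut_plane], which is
   connected, so these conditions determine [f] there; the values of [f] outside
   [cut_plane] are unconstrained. *)
Definition is_hyp2F1 (a b c : C) (f : C -> C) : Prop :=
  (forall z : C, (Cmod z < 1)%R ->
     is_series (fun n => pochhammer a n * pochhammer b n
                         / (Cfact n * pochhammer c n) * z ^ n) (f z)) /\
  analytic_on cut_plane f.

(* Likewise for (x, y) |-> F_1(a; b, b'; c; x, y) on [cut_plane] x [cut_plane]. *)
Definition is_appellF1 (a b b' c : C) (F : C -> C -> C) : Prop :=
  (forall x y : C, (Cmod x < 1)%R -> (Cmod y < 1)%R ->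
     is_series2 (fun p q => pochhammer a (p + q) * pochhammer b p * pochhammer b' q
                            / (Cfact p * Cfact q * pochhammer c (p + q))
                            * x ^ p * y ^ q) (F x y)) /\
  analytic2_on cut_plane F.

Definition divided_difference (T : C -> C) (x y : C) : C :=
  (T x - T y) / (x - y).

(* Main.v *)
Require Import Defs.
From Stdlib Require Import Reals Lra Lia.
From Coquelicot Require Import Coquelicot.
Open Scope C_scope.

(** On the unit bidisc the theorem is a computation with coefficients. The factor
    [(a)_(p+q) / (b)_(p+q)] of Appell's series is constant along the diagonals
    [p + q = n], and the remaining Pochhammer symbols and factorials cancel to [1]
    for the parameters [1, 1] and to [q + 1] for [1, 2]. Summing along the diagonals, which
    absolute convergence permits ([is_series2_diagonals]), leaves a single series
    in [n] whose terms contain the sum of [x ^ p * y ^ q], or of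
    [(q + 1) * x ^ p * y ^ q], over [p + q = n]. Multiplied by [x - y], respectively
    [(x - y) ^ 2], these become polynomials with two or three terms ([sum_powers],
    [sum_weighted_powers]), and each term is the general term of one of the
    series [2F1] on the right-hand side.

    The passage to the cut plane is analytic continuation. With the
    denominators cleared, the difference of the two sides is analytic in each
    variable separately, and it vanishes on the bidisc. The cut plane is star-shaped
    about [0], so each point is reached from the disc along a segment, where the
    identity theorem becomes one about real functions with local power series
    expansions ([analytic_unit_interval_zero]). Applying it to one variable at a
    time ([separately_analytic_star_zero]) avoids any
    identity theorem in two variables. *)

(** * Double series and their diagonals *)

(** Sums, opposites and scalings produced by lemmas on normed modules are
    operations of a structure on [C]; [ring] and [field] see them
    only once they are written with [Cplus], [Copp] and [Cmult]. *)
Ltac C_operations :=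
  match goal with |- @eq _ ?x ?y => change (@eq C x y) end;
  repeat match goal with
  | |- context [@plus ?G ?x ?y] => change (@plus G x y) with (Cplus x y)
  | |- context [@opp ?G ?x] => change (@opp G x) with (Copp x)
  | |- context [@scal ?K ?V ?x ?y] => change (@scal K V x y) with (Cmult x y)
  end.

Ltac C_ring := C_operations; ring.

Lemma is_series_unique_C (v : nat -> C) (l l' : C) :
  is_series v l -> is_series v l' -> l = l'.
Proof.
  apply (filterlim_locally_unique (V := C_NormedModule)).
Qed.

Lemma sum_n_le_upper (v : nat -> R) (m n : nat) :
  (forall k, (0 <= v k)%R) -> (m <= n)%nat -> (sum_n v m <= sum_n v n)%R.
Proof.
  intros Hv Hmn. induction Hmn as [|n Hmn IH]; [lra|].
  rewrite sum_Sn. unfold plus; simpl. specialize (Hv (S n)). lra.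
Qed.

Lemma sum_n_nonneg (v : nat -> R) (n : nat) :
  (forall k, (0 <= v k)%R) -> (0 <= sum_n v n)%R.
Proof.
  intros Hv. apply Rle_trans with (sum_n v 0).
  - rewrite sum_O. apply Hv.
  - apply sum_n_le_upper; auto with arith.
Qed.

(** Phrased with partial sums, this compares a tail of [v] with the same tail of
    its moduli without having to index the tail. *)
Lemma Cmod_sum_n_minus (v : nat -> C) (m n : nat) : (m <= n)%nat ->
  (Cmod (sum_n v n - sum_n v m)
   <= sum_n (fun k => Cmod (v k)) n - sum_n (fun k => Cmod (v k)) m)%R.
Proof.
  intros Hmn. induction Hmn as [|n Hmn IH].
  - replace (sum_n v m - sum_n v m) with (RtoC 0) by ring. rewrite Cmod_0. lra.
  - rewrite !sum_Sn. unfold plus; simpl.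
    replace (sum_n v n + v (S n) - sum_n v m)
      with ((sum_n v n - sum_n v m) + v (S n)) by ring.
    eapply Rle_trans; [apply Cmod_triangle|]. lra.
Qed.

Lemma Cmod_plus_minus_plus (z z' w w' : C) :
  (Cmod ((z + z') - (w + w')) <= Cmod (z - w) + Cmod (z' - w'))%R.
Proof.
  replace ((z + z') - (w + w')) with ((z - w) + (z' - w')) by ring.
  apply Cmod_triangle.
Qed.

(** Both sides run over the triangle [p + q <= N]; passing from [N] to [N + 1] adds
    one diagonal on the left and one term to every row on the right. *)
Lemma sum_n_diagonals {G : AbelianMonoid} (u : nat -> nat -> G) (N : nat) :
  sum_n (fun n => sum_n (fun p => u p (n - p)%nat) n) N
  = sum_n (fun p => sum_n (fun q => u p q) (N - p)) N.
Proof.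
  induction N as [|N IH].
  - now rewrite !sum_O.
  - rewrite sum_Sn, IH, (sum_Sn (fun p => u p (S N - p)%nat)), plus_assoc.
    rewrite <- sum_n_plus, (sum_Sn (fun p => sum_n _ (S N - p))).
    rewrite Nat.sub_diag, sum_O. f_equal.
    apply sum_n_ext_loc. intros p Hp.
    now rewrite Nat.sub_succ_l, sum_Sn.
Qed.

Lemma is_series2_squares (u : nat -> nat -> C) (l : C) : is_series2 u l ->
  filterlim (fun N => sum_n (fun p => sum_n (fun q => u p q) N) N)
    eventually (locally l).
Proof.
  intros [_ Hl].
  refine (filterlim_comp _ _ _ (fun N : nat => (N, N)) _ _ _ _ _ Hl).
  apply filterlim_pair; apply filterlim_id.
Qed.

(** An absolutely convergent double series may be summed along its diagonals. The
    sums of moduli over the square of side [N] and over the triangle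
    [p + q <= N] are interleaved, triangle N <= square N <= triangle 2N, and
    bounded, so they share a limit. The square and triangle sums of [u]
    itself differ by at most the difference of those, which tends to [0]. *)
Lemma is_series2_diagonals (u : nat -> nat -> C) (l : C) :
  is_series2 u l -> is_series (fun n => sum_n (fun p => u p (n - p)%nat) n) l.
Proof.
  intros [[M HM] Hl].
  set (sq := fun N => sum_n (fun p => sum_n (fun q => Cmod (u p q)) N) N).
  set (tr := fun N => sum_n (fun p => sum_n (fun q => Cmod (u p q)) (N - p)) N).
  assert (Hpos : forall p q, (0 <= Cmod (u p q))%R) by (intros; apply Cmod_ge_0).
  assert (Hpos1 : forall p n, (0 <= sum_n (fun q => Cmod (u p q)) n)%R)
    by (intros; now apply sum_n_nonneg).
  assert (Htr_sq : forall N, (tr N <= sq N)%R).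
  { intros N. apply sum_n_m_le. intros p. apply sum_n_le_upper; [auto|lia]. }
  assert (Hsq_tr : forall N, (sq N <= tr (2 * N)%nat)%R).
  { intros N. unfold sq, tr.
    eapply Rle_trans;
      [|apply sum_n_le_upper with (m := N) (n := (2 * N)%nat); [auto|lia]].
    rewrite !sum_n_Reals. apply sum_Rle. intros p Hp.
    apply sum_n_le_upper; [auto|lia]. }
  assert (Htr_lim : ex_finite_lim_seq tr).
  { apply ex_finite_lim_seq_incr with M.
    - intros N. unfold tr. rewrite <- !sum_n_diagonals.
      apply sum_n_le_upper; [|lia].
      intros n. apply sum_n_nonneg. auto.
    - intros N. eapply Rle_trans; [apply Htr_sq|]. apply HM. }
  destruct Htr_lim as [L HL].
  assert (HL2 : is_lim_seq (fun N => tr (2 * N)%nat) L).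
  { apply (is_lim_seq_subseq tr L (fun N => (2 * N)%nat)); [|exact HL].
    apply eventually_subseq. intros n. lia. }
  assert (Hsq_lim : is_lim_seq sq L).
  { apply is_lim_seq_le_le with (u := tr) (w := fun N => tr (2 * N)%nat); auto. }
  set (S2 := fun N => sum_n (fun p => sum_n (fun q => u p q) N) N).
  set (T2 := fun N => sum_n (fun p => sum_n (fun q => u p q) (N - p)) N).
  assert (Hdiff : forall N, (Cmod (S2 N - T2 N) <= sq N - tr N)%R).
  { intros N. unfold S2, T2, sq, tr.
    (* The induction on the number of rows needs a bound [K] on [p] that is
       independent of the [N] that governs the length of each row. *)
    assert (forall K, (K <= N)%nat ->
      (Cmod (sum_n (fun p => sum_n (fun q => u p q) N) K
             - sum_n (fun p => sum_n (fun q => u p q) (N - p)) K)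
       <= sum_n (fun p => sum_n (fun q => Cmod (u p q)) N) K
          - sum_n (fun p => sum_n (fun q => Cmod (u p q)) (N - p)) K)%R) as H;
      [|now apply H].
    induction K as [|K IH]; intros HK.
    - rewrite !sum_O. apply Cmod_sum_n_minus. lia.
    - rewrite !sum_Sn.
      pose proof (Cmod_sum_n_minus (u (S K)) (N - S K) N ltac:(lia)) as H1.
      specialize (IH ltac:(lia)). unfold plus; simpl.
      eapply Rle_trans; [apply Cmod_plus_minus_plus|].
      eapply Rle_trans; [apply Rplus_le_compat; [exact IH|exact H1]|].
      apply Req_le. ring. }
  assert (HS2 : filterlim S2 eventually (locally l))
    by (apply is_series2_squares; split; [now exists M|exact Hl]).
  assert (HD : filterlim (fun N => S2 N - T2 N) eventually (locally (RtoC 0))).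
  { apply (filterlim_norm_zero (V := C_NormedModule)).
    change (is_lim_seq (fun N => Cmod (S2 N - T2 N)) 0).
    apply is_lim_seq_le_le with (u := fun _ => 0%R) (w := fun N => (sq N - tr N)%R).
    - intros N. split; [apply Cmod_ge_0|apply Hdiff].
    - apply is_lim_seq_const.
    - replace 0%R with (L - L)%R by ring. now apply is_lim_seq_minus'. }
  unfold is_series.
  apply filterlim_ext with (fun N => plus (S2 N) (opp (S2 N - T2 N))).
  { intros N. rewrite sum_n_diagonals. change (S2 N + - (S2 N - T2 N) = T2 N). ring. }
  replace l with (l + - RtoC 0) by ring.
  eapply filterlim_comp_2; [exact HS2| |apply (filterlim_plus (V := C_NormedModule))].
  eapply filterlim_comp; [exact HD|apply (filterlim_opp (V := C_NormedModule))].
Qed.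

Lemma is_series2_swap (u : nat -> nat -> C) (l : C) :
  is_series2 u l -> is_series2 (fun p q => u q p) l.
Proof.
  intros [[M HM] Hl]. split.
  - exists M. intros P Q. rewrite sum_n_switch. apply HM.
  - eapply filterlim_ext; [intros PQ; apply sum_n_switch|].
    refine (filterlim_comp _ _ _ (fun PQ : nat * nat => (snd PQ, fst PQ))
      _ _ _ _ _ Hl).
    apply filterlim_pair; [apply filterlim_snd|apply filterlim_fst].
Qed.

(** Restricting a double power series to the line on which its second variable
    takes the value at the centre of the expansion leaves only the terms with
    [q = 0]. *)
Lemma is_series2_head_column (u : nat -> nat -> C) (l : C) :
  is_series2 u l -> (forall p q, u p (S q) = 0) -> is_series (fun p => u p 0%nat) l.
Proof.
  intros Hl Hu.
  assert (Hrow : forall p Q, sum_n (fun q => u p q) Q = u p 0%nat).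
  { intros p Q. induction Q as [|Q IH]; [now rewrite sum_O|].
    rewrite sum_Sn, IH, Hu. apply Cplus_0_r. }
  apply is_series2_squares in Hl. revert Hl. apply filterlim_ext. intros N. simpl.
  apply sum_n_ext. intros p. apply Hrow.
Qed.

(** * Identity theorem on a real segment *)

(** Zeros at points [w <> 0] accumulating at [0] suffice, on one side only if need
    be. Continuity at [0] kills the constant coefficient, and the quotient of the
    series by the variable, whose coefficients are [PS_decr_1 c], has the same
    zeros, so induction reaches every coefficient. *)
Lemma PSeries_coef_zero (n : nat) : forall c : nat -> R,
  Rbar_lt 0 (CV_radius c) ->
  (forall d : R, (0 < d)%R ->
     exists w : R, w <> 0%R /\ (Rabs w < d)%R /\ PSeries c w = 0%R) ->
  c n = 0%R.
Proof.
  assert (Hhead : forall c : nat -> R, Rbar_lt 0 (CV_radius c) ->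
    (forall d : R, (0 < d)%R ->
       exists w : R, w <> 0%R /\ (Rabs w < d)%R /\ PSeries c w = 0%R) ->
    c 0%nat = 0%R).
  { intros c Hc Hz. destruct (Req_dec (c 0%nat) 0) as [H0|H0]; [exact H0|exfalso].
    assert (Hcont : continuity_pt (PSeries c) 0)
      by (apply PSeries_continuity; now rewrite Rabs_R0).
    destruct (Hcont (Rabs (c 0%nat)) (Rabs_pos_lt _ H0)) as [d [Hd Hball]].
    destruct (Hz d Hd) as [w [Hw0 [Hwd Hw]]].
    assert (H : (R_dist (PSeries c w) (PSeries c 0) < Rabs (c 0%nat))%R).
    { apply Hball. split; [split; [exact I|now apply not_eq_sym]|].
      simpl. unfold R_dist. now rewrite Rminus_0_r. }
    rewrite Hw, PSeries_0 in H. unfold R_dist in H.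
    rewrite Rminus_0_l, Rabs_Ropp in H. lra. }
  induction n as [|n IH]; intros c Hc Hz; [now apply Hhead|].
  apply (IH (PS_decr_1 c)); [now rewrite CV_radius_decr_1|].
  intros d Hd. destruct (Hz d Hd) as [w [Hw0 [Hwd Hw]]].
  exists w. split; [exact Hw0|split; [exact Hwd|]].
  rewrite PSeries_decr_1_aux in Hw by now apply Hhead.
  apply Rmult_integral in Hw. tauto.
Qed.

Lemma CV_radius_pos (c : nat -> R) (w : R) :
  w <> 0%R -> ex_series (fun n => c n * w ^ n)%R -> Rbar_lt 0 (CV_radius c).
Proof.
  intros Hw Hs. apply Rbar_lt_le_trans with (Rabs w); [now apply Rabs_pos_lt|].
  apply Rbar_not_lt_le. intros H. apply (CV_disk_outside _ _ H).
  now apply ex_series_lim_0.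
Qed.

(** Let [s] be the supremum of the points up to which [u] vanishes. The expansion
    of [u] at [s] has zeros accumulating at [s] from the left, hence all its
    coefficients are [0], so [u] vanishes slightly beyond [s] as well. This is
    absurd unless [s = 1]. *)
Lemma analytic_unit_interval_zero (u : R -> R) (e : R) :
  (forall s : R, (0 <= s <= 1)%R ->
     exists (c : nat -> R) (r : R), (0 < r)%R /\
       forall t : R, (0 <= t <= 1)%R -> (Rabs (t - s) < r)%R ->
         is_series (fun n => c n * (t - s) ^ n)%R (u t)) ->
  (0 < e)%R -> (forall t : R, (0 <= t <= 1)%R -> (t < e)%R -> u t = 0%R) ->
  u 1%R = 0%R.
Proof.
  intros Hu He Hz.
  set (E := fun s : R => (0 <= s <= 1)%R /\ forall t : R, (0 <= t <= s)%R -> u t = 0%R).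
  destruct (completeness E) as [s [Hub Hleast]].
  - exists 1%R. intros s [Hs _]. lra.
  - exists 0%R. split; [lra|]. intros t Ht. apply Hz; lra.
  - assert (Hs0 : (0 < s)%R).
    { apply Rlt_le_trans with (Rmin (e / 2) 1).
      - apply Rmin_pos; lra.
      - apply Hub. assert (H1 := Rmin_l (e / 2) 1). assert (H2 := Rmin_r (e / 2) 1).
        assert (0 < Rmin (e / 2) 1)%R by (apply Rmin_pos; lra).
        split; [lra|]. intros t Ht. apply Hz; lra. }
    assert (Hs1 : (s <= 1)%R).
    { apply Hleast. intros t [Ht _]. lra. }
    assert (Hbelow : forall t, (0 <= t < s)%R -> u t = 0%R).
    { intros t Ht. destruct (Req_dec (u t) 0) as [H|H]; [exact H|exfalso].
      assert (s <= t)%R; [|lra]. apply Hleast. intros t' [Ht' Hzero].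
      destruct (Rle_lt_dec t' t) as [Hle|Hlt]; [exact Hle|].
      exfalso. apply H, Hzero. lra. }
    destruct (Hu s ltac:(lra)) as [c [r [Hr Hc]]].
    assert (Hc0 : forall n, c n = 0%R).
    { assert (Hacc : forall d, (0 < d)%R -> exists t,
        (0 <= t < s)%R /\ (Rabs (t - s) < d)%R /\ (Rabs (t - s) < r)%R).
      { (* Half the minimum: [s - h] stays positive, and within [d] and [r] of [s]. *)
        intros d Hd. set (h := (Rmin s (Rmin d r) / 2)%R).
        assert (H1 := Rmin_l s (Rmin d r)). assert (H2 := Rmin_r s (Rmin d r)).
        assert (H3 := Rmin_l d r). assert (H4 := Rmin_r d r).
        assert (0 < Rmin s (Rmin d r))%R by (repeat apply Rmin_pos; lra).
        exists (s - h)%R. replace (s - h - s)%R with (- h)%R by ring.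
        rewrite Rabs_Ropp, Rabs_pos_eq; unfold h; lra. }
      intros n. apply PSeries_coef_zero.
      - destruct (Hacc 1%R ltac:(lra)) as [t [Ht [_ Htr]]].
        apply CV_radius_pos with (t - s)%R; [lra|].
        exists (u t). apply Hc; [lra|exact Htr].
      - intros d Hd. destruct (Hacc d Hd) as [t [Ht [Htd Htr]]].
        exists (t - s)%R. split; [lra|split; [exact Htd|]].
        rewrite <- (Hbelow t Ht). apply is_pseries_unique, is_pseries_R, Hc;
          [lra|exact Htr]. }
    assert (Hnear : forall t, (0 <= t <= 1)%R -> (Rabs (t - s) < r)%R -> u t = 0%R).
    { intros t Ht Htr.
      rewrite <- (is_pseries_unique c (t - s)%R (u t)) by now apply is_pseries_R, Hc.
      rewrite (PSeries_ext _ (fun _ => 0%R)) by exact Hc0.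
      apply PSeries_const_0. }
    assert (Hall : forall t, (0 <= t <= 1)%R -> (t < s + r)%R -> u t = 0%R).
    { intros t Ht Htr. destruct (Rlt_le_dec t s) as [H|H]; [apply Hbelow; lra|].
      apply Hnear; [exact Ht|]. rewrite Rabs_pos_eq; lra. }
    destruct (Rlt_le_dec s 1) as [Hlt|Hle]; [exfalso|apply Hall; lra].
    set (s' := Rmin 1 (s + r / 2)).
    assert (H1 := Rmin_l 1 (s + r / 2)). assert (H2 := Rmin_r 1 (s + r / 2)).
    assert (s < s')%R by (apply Rmin_glb_lt; lra).
    assert (s' <= s)%R; [|lra].
    apply Hub. fold s' in H1, H2. split; [lra|]. intros t Ht. apply Hall; lra.
Qed.

(** * Operations on analytic functions *)

Lemma analytic_on_ext (D : C -> Prop) (f g : C -> C) :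
  (forall z, f z = g z) -> analytic_on D f -> analytic_on D g.
Proof.
  intros Hfg Hf z0 Hz0. destruct (Hf z0 Hz0) as [c [r [Hr Hc]]].
  exists c, r. split; [exact Hr|]. intros z Hz. rewrite <- Hfg. now apply Hc.
Qed.

Lemma analytic_on_plus (D : C -> Prop) (f g : C -> C) :
  analytic_on D f -> analytic_on D g -> analytic_on D (fun z => f z + g z).
Proof.
  intros Hf Hg z0 Hz0.
  destruct (Hf z0 Hz0) as [c [r [Hr Hc]]], (Hg z0 Hz0) as [d [s [Hs Hd]]].
  exists (fun n => c n + d n), (Rmin r s). split; [now apply Rmin_pos|].
  intros z Hz. assert (H1 := Rmin_l r s). assert (H2 := Rmin_r r s).
  eapply is_series_ext; [|apply (is_series_plus (V := C_NormedModule));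
    [apply (Hc z); lra|apply (Hd z); lra]].
  intros n. symmetry. apply Cmult_plus_distr_r.
Qed.

Lemma analytic_on_scal (D : C -> Prop) (k : C) (f : C -> C) :
  analytic_on D f -> analytic_on D (fun z => k * f z).
Proof.
  intros Hf z0 Hz0. destruct (Hf z0 Hz0) as [c [r [Hr Hc]]].
  exists (fun n => k * c n), r. split; [exact Hr|]. intros z Hz.
  eapply is_series_ext; [|apply (is_series_scal (V := C_NormedModule) k), (Hc z Hz)].
  intros n. apply Cmult_assoc.
Qed.

Lemma is_series_head_only (v : nat -> C) :
  (forall n, v (S n) = 0) -> is_series v (v 0%nat).
Proof.
  intros Hv. apply filterlim_ext with (fun _ => v 0%nat); [|apply filterlim_const].
  intros N. induction N as [|N IH]; [now rewrite sum_O|].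
  rewrite sum_Sn, <- IH, Hv. symmetry. apply Cplus_0_r.
Qed.

Lemma analytic_on_const (D : C -> Prop) (k : C) : analytic_on D (fun _ => k).
Proof.
  intros z0 _. exists (fun n => match n with O => k | S _ => 0 end), 1%R.
  split; [lra|]. intros z _.
  pose proof (is_series_head_only
    (fun n => match n with O => k | S _ => 0 end * (z - z0) ^ n)) as H.
  cbv beta iota in H. simpl Cpow in H at 2. rewrite Cmult_1_r in H.
  apply H. intros n. apply Cmult_0_l.
Qed.

(** Write [z - w] as [(z0 - w) + (z - z0)]: the first summand scales the expansion
    at [z0], the second shifts it by one degree. *)
Lemma analytic_on_mult_sub (D : C -> Prop) (w : C) (f : C -> C) :
  analytic_on D f -> analytic_on D (fun z => (z - w) * f z).
Proof.
  intros Hf z0 Hz0. destruct (Hf z0 Hz0) as [c [r [Hr Hc]]].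
  exists (fun n => (z0 - w) * c n + match n with O => 0 | S m => c m end), r.
  split; [exact Hr|]. intros z Hz. specialize (Hc z Hz).
  replace ((z - w) * f z) with ((z0 - w) * f z + (z - z0) * f z) by ring.
  apply is_series_ext with (fun n => plus ((z0 - w) * (c n * (z - z0) ^ n))
    (match n with O => 0 | S m => c m end * (z - z0) ^ n)).
  { intros n. C_ring. }
  apply (is_series_plus (V := C_NormedModule)).
  - apply (is_series_scal (V := C_NormedModule)), Hc.
  - apply is_series_decr_1.
    match goal with |- is_series _ ?L => replace L with ((z - z0) * f z) end.
    2: { simpl. C_ring. }
    eapply is_series_ext; [|apply (is_series_scal (V := C_NormedModule)), Hc].
    intros n. simpl. C_ring.
Qed.

Lemma analytic_on_mult_id (D : C -> Prop) (f : C -> C) :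
  analytic_on D f -> analytic_on D (fun z => z * f z).
Proof.
  intros Hf. apply analytic_on_ext with (fun z => (z - 0) * f z).
  - intros z. ring.
  - now apply analytic_on_mult_sub.
Qed.

Lemma analytic2_on_swap (D : C -> Prop) (F : C -> C -> C) :
  analytic2_on D F -> analytic2_on D (fun x y => F y x).
Proof.
  intros HF x0 y0 Hx0 Hy0. destruct (HF y0 x0 Hy0 Hx0) as [c [r [Hr Hc]]].
  exists (fun p q => c q p), r. split; [exact Hr|]. intros x y Hx Hy.
  destruct (is_series2_swap _ _ (Hc y x Hy Hx)) as [[M HM] Hl].
  assert (Hcomm : forall p q,
    c q p * (y - y0) ^ q * (x - x0) ^ p = c q p * (x - x0) ^ p * (y - y0) ^ q)
    by (intros; ring).
  split.
  - exists M. intros P Q. eapply Rle_trans; [|apply (HM P Q)]. apply Req_le.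
    apply sum_n_ext. intros p. apply sum_n_ext. intros q. now rewrite Hcomm.
  - revert Hl. apply filterlim_ext. intros [P Q].
    apply sum_n_ext. intros p. apply sum_n_ext. intros q. apply Hcomm.
Qed.

Lemma analytic2_on_fix_snd (D : C -> Prop) (F : C -> C -> C) (y : C) :
  analytic2_on D F -> D y -> analytic_on D (fun x => F x y).
Proof.
  intros HF Hy x0 Hx0. destruct (HF x0 y Hx0 Hy) as [c [r [Hr Hc]]].
  exists (fun p => c p 0%nat), r. split; [exact Hr|]. intros x Hx.
  apply is_series_ext with (fun p => c p 0%nat * (x - x0) ^ p * (y - y) ^ 0).
  { intros p. apply Cmult_1_r. }
  apply (is_series2_head_column
    (fun p q => c p q * (x - x0) ^ p * (y - y) ^ q)).
  - apply Hc; [exact Hx|]. replace (y - y) with (RtoC 0) by ring. now rewrite Cmod_0.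
  - intros p q. rewrite Cpow_S. ring.
Qed.

Lemma analytic2_on_fix_fst (D : C -> Prop) (F : C -> C -> C) (x : C) :
  analytic2_on D F -> D x -> analytic_on D (fun y => F x y).
Proof.
  intros HF. apply (analytic2_on_fix_snd D (fun y x => F x y)).
  now apply analytic2_on_swap.
Qed.

(** Matches the shape of the function syntactically: left to unification,
    [apply analytic_on_plus] may unfold the product of [C] into its components
    and search without end. *)
Ltac analytic :=
  lazymatch goal with
  | |- analytic_on _ (fun _ => ?k) => apply analytic_on_const
  | |- analytic_on ?D (fun z => Cplus (@?f z) (@?g z)) =>
      apply (analytic_on_plus D f g); analytic
  | |- analytic_on ?D (fun z => Cmult z (@?f z)) =>
      apply (analytic_on_mult_id D f); analytic
  | |- analytic_on ?D (fun z => Cmult (Cminus z ?w) (@?f z)) =>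
      apply (analytic_on_mult_sub D w f); analytic
  | |- analytic_on ?D (fun z => Cmult ?k (@?f z)) =>
      apply (analytic_on_scal D k f); analytic
  | |- _ => assumption
  end.

(** * Identity theorem on star-shaped domains *)

Lemma is_series_Re (v : nat -> C) (l : C) :
  is_series v l -> is_series (fun n => Re (v n)) (Re l).
Proof.
  intros H. unfold is_series.
  apply filterlim_ext with (fun N => Re (sum_n v N)).
  { induction x as [|N IH]; [now rewrite !sum_O|].
    rewrite !sum_Sn, <- IH. reflexivity. }
  apply filterlim_comp with (1 := H).
  apply filterlim_locally. intros eps. exists eps. intros z Hz. apply Hz.
Qed.

(** Along the ray [t |-> t * z], with [0 <= t <= 1], the real part of [g] is a real
    function with local power series expansions, and it vanishes while
    [t * z] is in the unit disc. *)
Lemma analytic_star_zero_Re (D : C -> Prop) (g : C -> C) :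
  (forall (z : C) (t : R), D z -> (0 <= t <= 1)%R -> D (t * z)) ->
  analytic_on D g -> (forall z, (Cmod z < 1)%R -> g z = 0) ->
  forall z, D z -> Re (g z) = 0%R.
Proof.
  intros Hstar Hg Hz0 z Hz.
  assert (Hz' := Cmod_ge_0 z).
  (* Radii in [t] are radii in [t * z] divided by [Cmod z + 1], not by [Cmod z],
     since [z] may be [0]. *)
  rewrite <- (Cmult_1_l z).
  apply (analytic_unit_interval_zero (fun t => Re (g (RtoC t * z))) (/ (Cmod z + 1))).
  - intros s Hs. destruct (Hg (s * z) (Hstar z s Hz Hs)) as [c [r [Hr Hc]]].
    exists (fun n => Re (c n * z ^ n)), (r / (Cmod z + 1))%R.
    split; [apply Rdiv_lt_0_compat; lra|].
    intros t Ht Hts.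
    assert (Heq : t * z - s * z = RtoC (t - s) * z) by (rewrite RtoC_minus; ring).
    eapply is_series_ext; [|apply is_series_Re, (Hc (t * z))].
    + intros n. rewrite Heq, Cpow_mult_l, <- RtoC_pow.
      generalize (c n) (z ^ n) ((t - s) ^ n)%R. intros. simpl. ring.
    + rewrite Heq, Cmod_mult, Cmod_R.
      apply Rle_lt_trans with (Rabs (t - s) * (Cmod z + 1))%R.
      * apply Rmult_le_compat_l; [apply Rabs_pos|lra].
      * apply Rlt_div_r in Hts; lra.
  - apply Rinv_0_lt_compat; lra.
  - intros t Ht Hlt. rewrite Hz0; [reflexivity|].
    rewrite Cmod_mult, Cmod_R, Rabs_pos_eq by lra.
    apply Rle_lt_trans with (t * (Cmod z + 1))%R.
    + apply Rmult_le_compat_l; lra.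
    + apply Rmult_lt_reg_r with (/ (Cmod z + 1))%R; [apply Rinv_0_lt_compat; lra|].
      rewrite Rmult_assoc, Rinv_r; lra.
Qed.

(** The imaginary part of [g] is the real part of [- Ci * g]. *)
Lemma analytic_star_zero (D : C -> Prop) (g : C -> C) :
  (forall (z : C) (t : R), D z -> (0 <= t <= 1)%R -> D (t * z)) ->
  analytic_on D g -> (forall z, (Cmod z < 1)%R -> g z = 0) ->
  forall z, D z -> g z = 0.
Proof.
  intros Hstar Hg Hz0 z Hz. apply injective_projections.
  - exact (analytic_star_zero_Re D g Hstar Hg Hz0 z Hz).
  - replace (snd (g z)) with (Re (- Ci * g z)) by (simpl; ring).
    apply (analytic_star_zero_Re D (fun z => - Ci * g z)); [exact Hstar| | |exact Hz].
    + now apply analytic_on_scal.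
    + intros z' Hz'. rewrite Hz0 by exact Hz'. ring.
Qed.

(** Continue first in the variable [x] with [y] in the unit disc, then in [y] with
    an arbitrary [x] in [D]. *)
Lemma separately_analytic_star_zero (D : C -> Prop) (G : C -> C -> C) :
  (forall (z : C) (t : R), D z -> (0 <= t <= 1)%R -> D (t * z)) ->
  (forall z, (Cmod z < 1)%R -> D z) ->
  (forall y, D y -> analytic_on D (fun x => G x y)) ->
  (forall x, D x -> analytic_on D (fun y => G x y)) ->
  (forall x y, (Cmod x < 1)%R -> (Cmod y < 1)%R -> G x y = 0) ->
  forall x y, D x -> D y -> G x y = 0.
Proof.
  intros Hstar Hdisc HG1 HG2 HG0 x y Hx Hy.
  apply (analytic_star_zero D (fun y => G x y)); auto.
  intros y' Hy'. apply (analytic_star_zero D (fun x => G x y')); auto.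
Qed.

Lemma cut_plane_star (z : C) (t : R) :
  cut_plane z -> (0 <= t <= 1)%R -> cut_plane (t * z).
Proof.
  destruct z as [u v]. unfold cut_plane. simpl. intros Hz Ht [Him Hre].
  apply Hz. replace (t * u - 0 * v)%R with (t * u)%R in Hre by ring.
  replace (t * v + 0 * u)%R with (t * v)%R in Him by ring.
  assert (Ht0 : (0 < t)%R) by (destruct (Req_dec t 0); [subst; lra|lra]).
  split; [|nra]. apply Rmult_integral in Him as [->|Hv]; [lra|exact Hv].
Qed.

Lemma unit_disc_cut_plane (z : C) : (Cmod z < 1)%R -> cut_plane z.
Proof.
  intros Hz [_ Hre]. assert (H1 := re_le_Cmod z). assert (H2 := Rle_abs (Re z)). lra.
Qed.

(** * Polynomial identities for the diagonals *)

Lemma sum_n_Cmult_l (k : C) (v : nat -> C) (n : nat) :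
  sum_n (fun p => k * v p) n = k * sum_n v n.
Proof. apply (sum_n_mult_l (K := C_Ring)). Qed.

Lemma sum_powers (x y : C) (n : nat) :
  (x - y) * sum_n (fun p => x ^ p * y ^ (n - p)) n = x ^ S n - y ^ S n.
Proof.
  induction n as [|n IH]; [rewrite sum_O; simpl; ring|].
  rewrite sum_Sn, Nat.sub_diag.
  rewrite (sum_n_ext_loc _ (fun p => y * (x ^ p * y ^ (n - p)))).
  - rewrite sum_n_Cmult_l.
    transitivity (y * ((x - y) * sum_n (fun p => x ^ p * y ^ (n - p)) n)
      + (x - y) * x ^ S n); [change (y ^ 0) with (RtoC 1); C_ring|].
    rewrite IH. simpl. ring.
  - intros p Hp. rewrite Nat.sub_succ_l by exact Hp. simpl. ring.
Qed.

(** The weighted sum is the derivative in [y] of the sum of powers of degree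
    [n + 1], so this is the derivative of [sum_powers] in that degree, multiplied by
    [x - y]. The induction uses h (n+1) = y * h n + (sum of powers of degree
    n + 1), where [h] is the weighted sum. *)
Lemma sum_weighted_powers (x y : C) (n : nat) :
  (x - y) ^ 2 * sum_n (fun p => RtoC (INR (S (n - p))) * (x ^ p * y ^ (n - p))) n
  = x ^ S (S n) - RtoC (INR (S (S n))) * x * y ^ S n
    + RtoC (INR (S n)) * y ^ S (S n).
Proof.
  induction n as [|n IH].
  - rewrite sum_O. simpl. rewrite RtoC_plus. ring.
  - set (h := fun m => sum_n (fun p => RtoC (INR (S (m - p))) * (x ^ p * y ^ (m - p))) m).
    assert (Hrec : h (S n)
        = y * h n + sum_n (fun p => x ^ p * y ^ (S n - p)) (S n)).
    { unfold h. rewrite !sum_Sn, Nat.sub_diag.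
      rewrite (sum_n_ext_loc _ (fun p => plus
        (y * (RtoC (INR (S (n - p))) * (x ^ p * y ^ (n - p))))
        (x ^ p * y ^ (S n - p)))).
      - rewrite sum_n_plus, sum_n_Cmult_l.
        change (RtoC (INR 1)) with (RtoC 1). C_ring.
      - intros p Hp. rewrite Nat.sub_succ_l by exact Hp.
        rewrite (S_INR (S (n - p))), RtoC_plus. simpl (y ^ _). C_ring. }
    transitivity ((x - y) ^ 2 * h (S n)); [reflexivity|]. rewrite Hrec.
    transitivity (y * ((x - y) ^ 2 * h n)
      + (x - y) * ((x - y) * sum_n (fun p => x ^ p * y ^ (S n - p)) (S n))); [ring|].
    unfold h. rewrite IH, sum_powers, (S_INR (S (S n))), (S_INR (S n)), !RtoC_plus.
    simpl. ring.
Qed.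

(** * Coefficients of the hypergeometric series *)

Definition pochhammer_ratio (a b : C) (n : nat) : C := pochhammer a n / pochhammer b n.

Lemma not_nonpos_int_neq_0 (b : C) : not_nonpos_int b -> b <> 0.
Proof.
  intros hb H. apply (hb O). rewrite H. simpl. now rewrite Ropp_0.
Qed.

Lemma not_nonpos_int_succ (b : C) : not_nonpos_int b -> not_nonpos_int (b + 1).
Proof.
  intros hb n H. apply (hb (S n)). rewrite S_INR.
  replace b with (b + 1 - 1) by ring. rewrite H, <- RtoC_minus. f_equal. ring.
Qed.

Lemma pochhammer_shift (q : C) (n : nat) :
  pochhammer q (S n) = q * pochhammer (q + 1) n.
Proof.
  induction n as [|n IH]; [simpl; ring|].
  change (pochhammer q (S (S n))) with (pochhammer q (S n) * (q + RtoC (INR (S n)))).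
  rewrite IH, S_INR, RtoC_plus. simpl. ring.
Qed.

Lemma pochhammer_1 (n : nat) : pochhammer 1 n = Cfact n.
Proof.
  induction n as [|n IH]; [reflexivity|]. simpl pochhammer. rewrite IH.
  unfold Cfact. rewrite fact_simpl, mult_INR, RtoC_mult, S_INR, RtoC_plus. ring.
Qed.

Lemma pochhammer_2 (n : nat) : pochhammer 2 n = RtoC (INR (S n)) * Cfact n.
Proof.
  replace (RtoC 2) with (1 + 1) by (rewrite <- RtoC_plus; f_equal; ring).
  rewrite <- (Cmult_1_l (pochhammer _ n)), <- pochhammer_shift, pochhammer_1.
  unfold Cfact. now rewrite fact_simpl, mult_INR, RtoC_mult.
Qed.

Lemma pochhammer_neq_0 (b : C) (n : nat) : not_nonpos_int b -> pochhammer b n <> 0.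
Proof.
  intros hb. induction n as [|n IH]; simpl.
  - apply C1_nz.
  - apply Cmult_neq_0; [exact IH|]. intros H. apply (hb n).
    rewrite RtoC_opp. replace b with (b + RtoC (INR n) - RtoC (INR n)) by ring.
    rewrite H. ring.
Qed.

Lemma Cfact_neq_0 (n : nat) : Cfact n <> 0.
Proof.
  intros H. apply (INR_fact_neq_0 n). now apply RtoC_inj.
Qed.

Lemma hyp2F1_1_series (a b : C) (f : C -> C) (z : C) :
  not_nonpos_int b -> is_hyp2F1 a 1 b f -> (Cmod z < 1)%R ->
  is_series (fun n => pochhammer_ratio a b n * z ^ n) (f z).
Proof.
  intros hb [Hf _] Hz. eapply is_series_ext; [|apply (Hf z Hz)].
  intros n. simpl. f_equal. rewrite pochhammer_1. unfold pochhammer_ratio.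
  assert (H1 := Cfact_neq_0 n). assert (H2 := pochhammer_neq_0 b n hb).
  field. now split.
Qed.

Lemma hyp2F1_2_series (a b : C) (f : C -> C) (z : C) :
  not_nonpos_int b -> is_hyp2F1 a 2 b f -> (Cmod z < 1)%R ->
  is_series (fun n => pochhammer_ratio a b n * RtoC (INR (S n)) * z ^ n) (f z).
Proof.
  intros hb [Hf _] Hz. eapply is_series_ext; [|apply (Hf z Hz)].
  intros n. cbv beta. f_equal. rewrite pochhammer_2. unfold pochhammer_ratio.
  assert (H1 := Cfact_neq_0 n). assert (H2 := pochhammer_neq_0 b n hb).
  field. now split.
Qed.

(** Since [a (a+1)_m / (b+1)_m = b (a)_(m+1) / (b)_(m+1)], multiplication by [a * z]
    shifts the series with parameters [a + 1, b + 1] onto the coefficients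
    [pochhammer_ratio a b]. The factor [INR n] makes the term of degree [0] vanish, as the
    shift requires. *)
Lemma hyp2F1_2_shift_series (a b : C) (f : C -> C) (z : C) :
  not_nonpos_int b -> is_hyp2F1 (a + 1) 2 (b + 1) f -> (Cmod z < 1)%R ->
  is_series (fun n => b * pochhammer_ratio a b n * RtoC (INR n) * z ^ n) (a * z * f z).
Proof.
  intros hb Hf Hz. apply is_series_decr_1.
  match goal with |- is_series _ ?L => replace L with (a * z * f z) end.
  2: { simpl. C_ring. }
  eapply is_series_ext; [|apply (is_series_scal (V := C_NormedModule) (a * z)),
    (hyp2F1_2_series _ _ _ _ (not_nonpos_int_succ b hb) Hf Hz)].
  intros n. unfold pochhammer_ratio. rewrite !pochhammer_shift.
  assert (H1 := not_nonpos_int_neq_0 b hb).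
  assert (H2 := pochhammer_neq_0 _ n (not_nonpos_int_succ b hb)).
  rewrite Cpow_S.
  C_operations. field. now split.
Qed.

(** * Identities on the bidisc and their continuation *)

Lemma appellF1_11_series (a b : C) (F : C -> C -> C) (x y : C) :
  not_nonpos_int b -> is_appellF1 a 1 1 b F -> (Cmod x < 1)%R -> (Cmod y < 1)%R ->
  is_series (fun n => pochhammer_ratio a b n * sum_n (fun p => x ^ p * y ^ (n - p)) n) (F x y).
Proof.
  intros hb [HF _] Hx Hy.
  eapply is_series_ext; [|apply is_series2_diagonals, (HF x y Hx Hy)].
  intros n. rewrite <- sum_n_Cmult_l.
  apply sum_n_ext_loc. intros p Hp. cbv beta.
  replace (p + (n - p))%nat with n by lia. rewrite !pochhammer_1. unfold pochhammer_ratio.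
  assert (H1 := Cfact_neq_0 p). assert (H2 := Cfact_neq_0 (n - p)).
  assert (H3 := pochhammer_neq_0 b n hb).
  C_operations. field. auto.
Qed.

Lemma appellF1_12_series (a b : C) (F : C -> C -> C) (x y : C) :
  not_nonpos_int b -> is_appellF1 a 1 2 b F -> (Cmod x < 1)%R -> (Cmod y < 1)%R ->
  is_series (fun n => pochhammer_ratio a b n
    * sum_n (fun p => RtoC (INR (S (n - p))) * (x ^ p * y ^ (n - p))) n) (F x y).
Proof.
  intros hb [HF _] Hx Hy.
  eapply is_series_ext; [|apply is_series2_diagonals, (HF x y Hx Hy)].
  intros n. rewrite <- sum_n_Cmult_l.
  apply sum_n_ext_loc. intros p Hp. cbv beta.
  replace (p + (n - p))%nat with n by lia. rewrite pochhammer_1, pochhammer_2.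
  unfold pochhammer_ratio.
  assert (H1 := Cfact_neq_0 p). assert (H2 := Cfact_neq_0 (n - p)).
  assert (H3 := pochhammer_neq_0 b n hb).
  C_operations. field. auto.
Qed.

(** Stated without the denominator, so that both sides are analytic on the diagonal
    [x = y] too and can be continued across it. *)
Lemma appellF1_11_disc (a b : C) (F : C -> C -> C) (f : C -> C) (x y : C) :
  not_nonpos_int b -> is_appellF1 a 1 1 b F -> is_hyp2F1 a 1 b f ->
  (Cmod x < 1)%R -> (Cmod y < 1)%R ->
  (x - y) * F x y = x * f x - y * f y.
Proof.
  intros hb HF Hf Hx Hy.
  eapply is_series_unique_C.
  - apply (is_series_scal (V := C_NormedModule) (x - y)),
      (appellF1_11_series a b F x y hb HF Hx Hy).
  - eapply is_series_ext; [|apply (is_series_minus (V := C_NormedModule));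
      [apply (is_series_scal (V := C_NormedModule) x), (hyp2F1_1_series a b f x hb Hf Hx)
      |apply (is_series_scal (V := C_NormedModule) y), (hyp2F1_1_series a b f y hb Hf Hy)]].
    intros n. symmetry.
    transitivity (pochhammer_ratio a b n
      * ((x - y) * sum_n (fun p => x ^ p * y ^ (n - p)) n)); [C_ring|].
    rewrite sum_powers. simpl. unfold minus. C_ring.
Qed.

(** By [sum_weighted_powers], [b * (x - y) ^ 2] times the diagonal of degree [n] has
    three terms: the one in [x ^ (n+2)] gives [f x], the one in [y ^ (n+2)] gives
    [g y], and [(n + 2) * x * y ^ (n+1)] splits into a part with weight [n],
    which is [h y], and a part with weight [2], which is [f y]. *)
Lemma appellF1_12_disc (a b : C) (F : C -> C -> C) (f g h : C -> C) (x y : C) :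
  not_nonpos_int b -> is_appellF1 a 1 2 b F -> is_hyp2F1 a 1 b f ->
  is_hyp2F1 a 2 b g -> is_hyp2F1 (a + 1) 2 (b + 1) h ->
  (Cmod x < 1)%R -> (Cmod y < 1)%R ->
  b * (x - y) ^ 2 * F x y
  = b * x ^ 2 * f x + b * y ^ 2 * g y
    + x * (- a * y ^ 2 * h y - 2 * b * y * f y).
Proof.
  intros hb HF Hf Hg Hh Hx Hy.
  eapply is_series_unique_C.
  - apply (is_series_scal (V := C_NormedModule) (b * (x - y) ^ 2)),
      (appellF1_12_series a b F x y hb HF Hx Hy).
  - assert (H1 := is_series_scal (V := C_NormedModule) (b * x ^ 2) _ _
      (hyp2F1_1_series a b f x hb Hf Hx)).
    assert (H2 := is_series_scal (V := C_NormedModule) (b * y ^ 2) _ _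
      (hyp2F1_2_series a b g y hb Hg Hy)).
    assert (H3 := is_series_scal (V := C_NormedModule) (- x * y) _ _
      (hyp2F1_2_shift_series a b h y hb Hh Hy)).
    assert (H4 := is_series_scal (V := C_NormedModule) (- (2) * b * x * y) _ _
      (hyp2F1_1_series a b f y hb Hf Hy)).
    assert (H := is_series_plus (V := C_NormedModule) _ _ _ _
      (is_series_plus (V := C_NormedModule) _ _ _ _ H1 H2)
      (is_series_plus (V := C_NormedModule) _ _ _ _ H3 H4)).
    match type of H with is_series _ ?L => match goal with |- is_series _ ?L' =>
      replace L' with L by C_ring end end.
    revert H. apply is_series_ext. intros n. symmetry.
    transitivity (b * pochhammer_ratio a b n * ((x - y) ^ 2
      * sum_n (fun p => RtoC (INR (S (n - p))) * (x ^ p * y ^ (n - p))) n)); [C_ring|].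
    rewrite sum_weighted_powers, !S_INR, !RtoC_plus, !Cpow_S. C_ring.
Qed.

Lemma appellF1_11_cut_plane (a b : C) (F : C -> C -> C) (f : C -> C) (x y : C) :
  not_nonpos_int b -> is_appellF1 a 1 1 b F -> is_hyp2F1 a 1 b f ->
  cut_plane x -> cut_plane y ->
  (x - y) * F x y = x * f x - y * f y.
Proof.
  intros hb HF Hf Hx Hy. apply Ceq_minus.
  revert x y Hx Hy. apply separately_analytic_star_zero.
  - exact cut_plane_star.
  - exact unit_disc_cut_plane.
  - intros y Hy.
    assert (HFy := analytic2_on_fix_snd _ F y (proj2 HF) Hy).
    assert (Hfa := proj2 Hf).
    apply analytic_on_ext with
      (fun x => (x - y) * F x y + ((-1) * (x * f x) + y * f y)).
    + intros x. ring.
    + analytic.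
  - intros x Hx.
    assert (HFx := analytic2_on_fix_fst _ F x (proj2 HF) Hx).
    assert (Hfa := proj2 Hf).
    apply analytic_on_ext with
      (fun y => (-1) * ((y - x) * F x y) + (y * f y + (-1) * (x * f x))).
    + intros y. ring.
    + analytic.
  - intros x y Hx Hy.
    rewrite (appellF1_11_disc a b F f x y) by assumption. ring.
Qed.

Lemma appellF1_12_cut_plane (a b : C) (F : C -> C -> C) (f g h : C -> C) (x y : C) :
  not_nonpos_int b -> is_appellF1 a 1 2 b F -> is_hyp2F1 a 1 b f ->
  is_hyp2F1 a 2 b g -> is_hyp2F1 (a + 1) 2 (b + 1) h ->
  cut_plane x -> cut_plane y ->
  b * (x - y) ^ 2 * F x y
  = b * x ^ 2 * f x + b * y ^ 2 * g y
    + x * (- a * y ^ 2 * h y - 2 * b * y * f y).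
Proof.
  intros hb HF Hf Hg Hh Hx Hy. apply Ceq_minus.
  revert x y Hx Hy. apply separately_analytic_star_zero.
  - exact cut_plane_star.
  - exact unit_disc_cut_plane.
  - intros y Hy.
    assert (HFy := analytic2_on_fix_snd _ F y (proj2 HF) Hy).
    assert (Hfa := proj2 Hf).
    apply analytic_on_ext with (fun x =>
      b * ((x - y) * ((x - y) * F x y)) + ((- b) * (x * (x * f x))
      + (- (b * y ^ 2 * g y) + x * (a * y ^ 2 * h y + 2 * b * y * f y)))).
    + intros x. ring.
    + analytic.
  - intros x Hx.
    assert (HFx := analytic2_on_fix_fst _ F x (proj2 HF) Hx).
    assert (Hfa := proj2 Hf). assert (Hga := proj2 Hg). assert (Hha := proj2 Hh).
    apply analytic_on_ext with (fun y =>
      b * ((y - x) * ((y - x) * F x y)) + (- (b * x ^ 2 * f x)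
      + ((- b) * (y * (y * g y)) + ((a * x) * (y * (y * h y))
      + (2 * b * x) * (y * f y))))).
    + intros y. ring.
    + analytic.
  - intros x y Hx Hy.
    rewrite (appellF1_12_disc a b F f g h x y) by assumption. ring.
Qed.

Theorem proposition2p8 (a b : C) (hb : not_nonpos_int b)
    (F11 F12 : C -> C -> C) (f_a1b f_a2b f_a'2b' : C -> C)
    (hF11 : is_appellF1 a 1 1 b F11)
    (hF12 : is_appellF1 a 1 2 b F12)
    (hf_a1b : is_hyp2F1 a 1 b f_a1b)
    (hf_a2b : is_hyp2F1 a 2 b f_a2b)
    (hf_a'2b' : is_hyp2F1 (a + 1) 2 (b + 1) f_a'2b')
    (x y : C) (hx : cut_plane x) (hy : cut_plane y) (hxy : x <> y) :
  F11 x y = (x * f_a1b x - y * f_a1b y) / (x - y) /\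
  F11 x y = divided_difference (fun z => z * f_a1b z) x y /\
  F12 x y =
    1 / (b * (x - y) ^ 2) *
    (b * x ^ 2 * f_a1b x + b * y ^ 2 * f_a2b y
     + x * (- a * y ^ 2 * f_a'2b' y - 2 * b * y * f_a1b y)).
Proof.
  assert (Hxy : x - y <> 0) by (intros H; now apply hxy, Ceq_minus).
  assert (Hb := not_nonpos_int_neq_0 b hb).
  assert (H11 : F11 x y = (x * f_a1b x - y * f_a1b y) / (x - y)).
  { rewrite <- (appellF1_11_cut_plane a b F11 f_a1b x y) by assumption.
    field. exact Hxy. }
  split; [exact H11|split; [exact H11|]].
  rewrite <- (appellF1_12_cut_plane a b F12 f_a1b f_a2b f_a'2b' x y) by assumption.
  field. now split.
Qed.
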